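(* For every $n\ge 1$, the peak algebra $\mathcal{P}_n$ is a subalgebra of the descent algebra $\Sigma(A_{n-1})$ of $\mathfrak{S}_n$. Moreover, $\mathcal{P}_n=\varphi(\Sigma(B_n))=\psi(\Sigma(D_n))$.
   Context: $[m]=\{1,\dots,m\}$. $\mathfrak{S}_n$ is the symmetric group; $u\in\mathfrak{S}_n$ is written $u_1\dots u_n$ with $u_i=u(i)$; group algebras are over $\mathbb{Q}$ with product given by composition $(uv)(i)=u(v(i))$. For $u\in\mathfrak{S}_n$, $\mathrm{Des}(u)=\{i\in[n-1]: u_i>u_{i+1}\}$, and for $J\subseteq[n-1]$, $Y_J=\sum_{\mathrm{Des}(u)=J}u$; $\Sigma(A_{n-1})$ is the span of the $Y_J$. $B_n$ is the group of signed permutations: bijections $w$ of $\{\pm1,\dots,\pm n\}$ with $w(-i)=-w(i)$, written $w_1\dots w_n$, $w_i=w(i)$; these values are ordered $\cdots<-2<-1<1<2<\cdots$ and one sets $w_0=0$. $\mathrm{Des}(w)=\{i\in\{0,\dots,n-1\}: w_i>w_{i+1}\}$, and $\Sigma(B_n)$ is the span in $\mathbb{Q}B_n$ of $Y_J=\sum_{\mathrm{Des}(w)=J}w$, $J\subseteq\{0,\dots,n-1\}$. $D_n\subseteq B_n$ is the subgroup of signed permutations with an even number of negative entries; for $w\in D_n$, its descent set is the subset of $\{1',1,2,\dots,n-1\}$ where $1'$ is a descent iff $-w_1>w_2$ and $i\in[n-1]$ is a descent iff $w_i>w_{i+1}$; $\Sigma(D_n)$ is the span of $Y_J=\sum_{\mathrm{Des}(w)=J}w$,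 $J\subseteq\{1',1,\dots,n-1\}$. $\varphi:\mathbb{Q}B_n\to\mathbb{Q}\mathfrak{S}_n$ is the linear extension of forgetting signs, $w\mapsto |w_1|\dots|w_n|$, and $\psi$ is its restriction to $\mathbb{Q}D_n$. For $u\in\mathfrak{S}_n$, $\mathrm{Peak}(u)=\{i\in[n-1]: u_{i-1}<u_i>u_{i+1}\}$ with convention $u_0=0$. $\mathcal{F}_n$ is the set of subsets of $[n-1]$ containing no two consecutive integers, $P_F=\sum_{\mathrm{Peak}(u)=F}u$ for $F\in\mathcal{F}_n$, and $\mathcal{P}_n=\mathrm{span}\{P_F: F\in\mathcal{F}_n\}$. *)

(* Defs.v *)
From mathcomp Require Import all_boot all_order all_algebra all_fingroup.
Set Implicit Arguments. Unset Strict Implicit. Unset Printing Implicit Defensive.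
Import Order.TTheory GRing.Theory Num.Theory.
Local Open Scope ring_scope.

(* Group algebra Q[T] of a finite set T: functions T -> rat
   (an element f stands for \sum_t f t * t). *)
Notation galg T := {ffun T -> rat}.

Definition gbasis (T : finType) (t : T) : galg T := [ffun x => (x == t)%:R].

Definition in_span (I T : finType) (P : pred I) (Y : I -> galg T) (f : galg T) :=
  exists c : I -> rat, f = [ffun t => \sum_(i | P i) c i * Y i t].

(* Positions 1..n and values 1..n are shifted by one w.r.t. 'I_n.
   One-line word u_1 ... u_n of u, as natural numbers. *)
Definition sword n (u : 'S_n) : seq nat := [seq (u i).+1 | i <- enum 'I_n].
Definition sval n (u : 'S_n) (k : nat) : nat := nth 0 (0 :: sword u) k.

(* Composition (u v)(i) = u (v i); mathcomp's perm product is (v * u) x = u (v x). *)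
Definition scomp n (u v : 'S_n) : 'S_n := (v * u)%g.

Definition smul n (f g : galg ('S_n)) : galg ('S_n) :=
  [ffun w => \sum_(u : 'S_n) \sum_(v : 'S_n) if scomp u v == w then f u * g v else 0].

(* Subsets of [n-1] are encoded as sets J : {set 'I_n} with 0 \notin J
   (element i : 'I_n stands for the integer i). *)
Definition subset_n1 n (J : {set 'I_n}) : bool := 0%N \notin [seq val i | i in J].

Definition sDes n (u : 'S_n) : {set 'I_n} :=
  [set i : 'I_n | (0 < val i)%N && (sval u (val i) > sval u (val i).+1)%N].

Definition YA n (J : {set 'I_n}) : galg ('S_n) :=
  [ffun u => (sDes u == J)%:R].

Definition in_SigmaA n (f : galg ('S_n)) := in_span (@subset_n1 n) (@YA n) f.

Definition Peak n (u : 'S_n) : {set 'I_n} :=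
  [set i : 'I_n | [&& (0 < val i)%N, (sval u (val i).-1 < sval u (val i))%N
                    & (sval u (val i) > sval u (val i).+1)%N]].

Definition in_Fn n (F : {set 'I_n}) : bool :=
  subset_n1 F && [forall i : 'I_n, forall j : 'I_n, (i \in F) ==> (j \in F) ==> (val j != (val i).+1)].

Definition PF n (F : {set 'I_n}) : galg ('S_n) :=
  [ffun u => (Peak u == F)%:R].

Definition in_Peak n (f : galg ('S_n)) := in_span (@in_Fn n) (@PF n) f.

(* A signed permutation w is encoded by (s, e) with w(i) = (-1)^(e i) s(i)
   (shifted by one as above). *)
Definition Bn n := ('S_n * {ffun 'I_n -> bool})%type.

Definition bword n (w : Bn n) : seq int :=
  [seq (if w.2 i then -1 else 1) * ((w.1 i).+1)%:Z | i <- enum 'I_n].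
Definition bval n (w : Bn n) (k : nat) : int := nth 0 (0 :: bword w) k.

Definition bDes n (w : Bn n) : {set 'I_n} :=
  [set i : 'I_n | bval w (val i) > bval w (val i).+1].

Definition YB n (J : {set 'I_n}) : galg (Bn n) :=
  [ffun w => (bDes w == J)%:R].

Definition in_SigmaB n (f : galg (Bn n)) := in_span predT (@YB n) f.

Definition inDn n (w : Bn n) : bool := ~~ odd #|[set i | w.2 i]|.

(* Descent set of w in D_n, a subset of {1',1,...,n-1}; here 1' is
   encoded by 0 : 'I_n and i in [n-1] by i : 'I_n. *)
Definition dDes n (w : Bn n) : {set 'I_n} :=
  [set i : 'I_n | if val i == 0%N then - bval w 1 > bval w 2
                  else bval w (val i) > bval w (val i).+1].

(* Y_J in Q D_n, viewed inside Q B_n (supported on D_n) *)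
Definition YD n (J : {set 'I_n}) : galg (Bn n) :=
  [ffun w => (inDn w && (dDes w == J))%:R].

Definition in_SigmaD n (f : galg (Bn n)) := in_span predT (@YD n) f.

(* phi : Q B_n -> Q S_n, linear extension of forgetting signs w |-> |w_1|...|w_n|;
   psi is its restriction to Q D_n. *)
Definition phi n (f : galg (Bn n)) : galg ('S_n) :=
  [ffun u => \sum_(w : Bn n | w.1 == u) f w].

(* Main.v *)
Require Import Defs.
From HB Require Import structures.
From mathcomp Require Import all_boot all_order all_algebra all_fingroup.
From mathcomp Require Import zify lra.

(* The peak algebra consists of the functions on S_n that are constant on peak classes; since the peak
   set is determined by the descent set, it lies in Sigma(A_{n-1}).

   Summing over the signs attached to u, the coefficient of u in phi(Y_J) (type B) is
   2^{#Peak(u)} if every peak i of u satisfies exactly one of i-1 in J, i in J, and 0 otherwise. Choosing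
   J to switch exactly at the elements of F makes this system triangular for inclusion of peak sets,
   whence phi(Sigma(B_n)) = P_n. In type D the sign of the entry of absolute value 1 never influences
   a descent, so restricting to an even number of signs halves the count, and the count differs
   from the one in type B by a factor that only depends on J and on whether 1 is a peak.

   As phi is multiplicative, closure of P_n under products follows from Solomon's theorem for B_n.
   For that, let s be a simple reflection exchanging adjacent values. Either Des(su) = Des(u) or
   su = us' with s' simple. If Des(sw) = Des(w), then
   (u,v) -> (su,v) or (u,s'v) respectively is a descent preserving bijection between the factorizations
   w = uv and those of sw. Descent classes are connected under such moves, because each contains a single
   element that no move brings lower in the left weak order. *)

Set Implicit Arguments. Unset Strict Implicit. Unset Printing Implicit Defensive.
Import Order.TTheory GRing.Theory Num.Theory.
Local Open Scope ring_scope.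

(** * Spans of indicator functions and signed permutations *)

(** Evaluating at [t] leaves only the term of [D t], so coefficients are values of [f] on fibres.
    Membership in $\Sigma(A_{n-1})$, $\Sigma(B_n)$ and $\mathcal{P}_n$ thus becomes constancy on
    classes. *)
Lemma in_span_fibres (T I : finType) (D : T -> I) (P : pred I) (f : galg T) :
  (forall t, P (D t)) ->
  in_span P (fun i => [ffun t => (D t == i)%:R]) f <->
  (forall t t', D t = D t' -> f t = f t').
Proof.
move=> PD.
have sumE (c : I -> rat) t :
    \sum_(i | P i) c i * [ffun t => (D t == i)%:R : rat] t = c (D t).
  rewrite (bigD1 (D t)) ?PD //= ffunE eqxx mulr1 big1 ?addr0 // => i /andP[_ ni].
  by rewrite ffunE eq_sym (negbTE ni) mulr0.
split=> [[c ->] t t' e | fD]; first by rewrite !ffunE !sumE e.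
(* An empty fibre receives the arbitrary coefficient 0. *)
exists (fun i => oapp f 0 [pick t | D t == i]).
apply/ffunP=> t; rewrite ffunE sumE; case: pickP => [t' /eqP e | /(_ t)] /=.
  exact/esym/fD.
by rewrite eqxx.
Qed.

Definition signed (n : nat) : Type := Bn n.
HB.instance Definition _ (n : nat) := Finite.on (signed n).

Section SignedGroup.
Variable n : nat.
Implicit Types u v w : signed n.

Definition signed_mul u v : signed n :=
  ((v.1 * u.1)%g, [ffun i => v.2 i (+) u.2 (v.1 i)]).
Definition signed_one : signed n := (1%g, [ffun=> false]).
Definition signed_inv u : signed n := (u.1^-1%g, [ffun i => u.2 (u.1^-1%g i)]).

Lemma signed_mulA : associative signed_mul.
Proof.
move=> u v w; congr pair => /=; first by rewrite mulgA.
by apply/ffunP=> i; rewrite !ffunE permM addbA.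
Qed.

Lemma signed_mul1 : left_id signed_one signed_mul.
Proof.
case=> u e; rewrite /signed_mul /= mulg1; congr pair.
by apply/ffunP=> i; rewrite !ffunE addbF.
Qed.

Lemma signed_mulV : left_inverse signed_one signed_inv signed_mul.
Proof.
case=> u e; rewrite /signed_mul /= mulgV; congr pair.
by apply/ffunP=> i; rewrite !ffunE permK addbb.
Qed.

HB.instance Definition _ :=
  Finite_isGroup.Build (signed n) signed_mulA signed_mul1 signed_mulV.

Lemma signed_mulE u v : (u * v)%g = signed_mul u v. Proof. by []. Qed.

Lemma signed_oneE : (1%g : signed n) = signed_one. Proof. by []. Qed.

Lemma bval_ord w (i : 'I_n) :
  bval w i.+1 = (if w.2 i then -1 else 1) * (w.1 i).+1%:Z.
Proof.
rewrite /bval /= /bword (nth_map i) ?size_enum_ord //.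
by rewrite nth_ord_enum.
Qed.

Lemma bval0 w : bval w 0 = 0. Proof. by []. Qed.

Lemma bval_out w k : (n < k)%N -> bval w k = 0.
Proof. by move=> lt; rewrite /bval nth_default //= size_map size_enum_ord. Qed.

(* A signed permutation as an odd function on the integers, vanishing outside [-n, n]. *)
Definition sact w (z : int) : int :=
  match z with Posz k => bval w k | Negz k => - bval w k.+1 end.

Lemma sactN w z : sact w (- z) = - sact w z.
Proof. by case: z => [[|k]|k] //=; rewrite ?opprK //. Qed.

Lemma sact0 w : sact w 0 = 0. Proof. by []. Qed.

Lemma sact_ord w (i : 'I_n) :
  sact w i.+1%:Z = (if w.2 i then -1 else 1) * (w.1 i).+1%:Z.
Proof. exact: bval_ord. Qed.

Lemma sact_ind (P : int -> Prop) :
  P 0 -> (forall i : 'I_n, P i.+1%:Z) -> (forall z, P z -> P (- z)) ->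
  forall z, `|z| <= n%:Z -> P z.
Proof.
move=> P0 Pp PN z lez.
have Ppos (k : nat) : (k <= n)%N -> P k%:Z.
  by case: k => [|k] // lt; apply: (Pp (Ordinal lt)).
case: z lez => k lek; first by apply: Ppos; lia.
by rewrite NegzE; apply/PN/Ppos; lia.
Qed.

Lemma sactM u v z : sact (u * v)%g z = sact u (sact v z).
Proof.
have [lez | ltz] := boolP (`|z| <= n%:Z); last first.
  have out w : sact w z = 0.
    by case: z ltz => k lt /=; rewrite bval_out ?oppr0 //; lia.
  by rewrite !out.
elim/sact_ind: z / lez => [//|i|z IH]; last by rewrite !sactN IH.
rewrite !sact_ord signed_mulE /= ffunE permM.
by case: (v.2 i); rewrite [in RHS](mulN1r, mul1r) ?sactN sact_ord; case: (u.2 _) => /=; lia.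
Qed.

Lemma sact1 z : `|z| <= n%:Z -> sact 1%g z = z.
Proof.
elim/sact_ind: z / => [//|i|z IH]; last by rewrite sactN IH.
by rewrite sact_ord signed_oneE /= ffunE perm1 mul1r.
Qed.

Lemma sactK w z : `|z| <= n%:Z -> sact w^-1%g (sact w z) = z.
Proof. by move=> lez; rewrite -sactM mulVg sact1. Qed.

Lemma sactKV w z : `|z| <= n%:Z -> sact w (sact w^-1%g z) = z.
Proof. by move=> lez; rewrite -sactM mulgV sact1. Qed.

Lemma sact_le w z : `|sact w z| <= n%:Z.
Proof.
have [lez | ltz] := boolP (`|z| <= n%:Z); last first.
  by case: z ltz => k lt /=; rewrite bval_out ?oppr0 //; lia.
elim/sact_ind: z / lez => [//|i|z IH]; last by rewrite sactN normrN.
by rewrite sact_ord; have := ltn_ord (w.1 i); case: (w.2 i); lia.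
Qed.

Arguments sact w z : simpl never.

Lemma sact_inj w z z' :
  `|z| <= n%:Z -> `|z'| <= n%:Z -> sact w z = sact w z' -> z = z'.
Proof. by move=> lez lez' e; rewrite -(sactK w lez) e sactK. Qed.

Lemma sact_faithful u v :
  (forall z, 0 < z -> z <= n%:Z -> sact u z = sact v z) -> u = v.
Proof.
move=> e; have E i : u.2 i = v.2 i /\ u.1 i = v.1 i.
  have := e i.+1%:Z; rewrite !sact_ord => /(_ _)/(_ _) E.
  have {}E : (if u.2 i then -1 else 1) * (u.1 i).+1%:Z
           = (if v.2 i then -1 else 1) * (v.1 i).+1%:Z.
    by apply: E => //; have := ltn_ord i; lia.
  split; first by case: (u.2 i) E; case: (v.2 i); lia.
  by apply/val_inj => /=; case: (u.2 i) E; case: (v.2 i); lia.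
case: u v E {e} => [u d] [v e] /= E; congr pair; first by apply/permP=> i; case: (E i).
by apply/ffunP=> i; case: (E i).
Qed.

(* [gen k] exchanges the values k and k+1 (up to sign) if 0 < k, and the values 1 and -1 if k = 0. *)
Definition gen (k : 'I_n) : signed n :=
  if k == 0%N :> nat then (1%g, [ffun i => i == k])
  else (tperm (Ordinal (leq_ltn_trans (leq_pred k) (ltn_ord k))) k, [ffun=> false]).

Definition flip (k : nat) (z : int) : int :=
  if k == 0%N then (if (z == 1) || (z == -1) then - z else z)
  else if z == k%:Z then z + 1 else if z == k%:Z + 1 then z - 1
  else if z == - k%:Z then z - 1 else if z == - k%:Z - 1 then z + 1 else z.

Lemma sact_gen (k : 'I_n) z : `|z| <= n%:Z -> sact (gen k) z = flip k z.
Proof.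
elim/sact_ind: z / => [|i|z IH].
- by rewrite /flip; case: (val k) => [|m] //=; repeat case: ifP => //; lia.
- rewrite sact_ord /gen /flip; case k0: (k == 0%N :> nat) => /=.
    by rewrite ffunE perm1 -val_eqE /=; repeat case: ifP => //; lia.
  rewrite ffunE mul1r; case: tpermP => [->|->|] /=; try by repeat case: ifP => //; lia.
  by move=> /eqP; rewrite -!val_eqE /= => h1 /eqP; rewrite -val_eqE /= => h2; repeat case: ifP => //; lia.
- by rewrite sactN IH /flip; repeat case: ifP => //; lia.
Qed.

Lemma flipK k : involutive (flip k).
Proof. by move=> z; rewrite /flip; repeat case: ifP => //; lia. Qed.

Lemma flip0 k : flip k 0 = 0.
Proof. by rewrite /flip; repeat case: ifP => //; lia. Qed.

Lemma flip_le (k : 'I_n) z : `|z| <= n%:Z -> `|flip k z| <= n%:Z.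
Proof. by move=> lez; rewrite -sact_gen // sact_le. Qed.

Lemma genK (k : 'I_n) : (gen k * gen k)%g = 1%g.
Proof.
apply: sact_faithful => z z0 zn; have lez : `|z| <= n%:Z by lia.
by rewrite sactM sact1 // (sact_gen k lez) sact_gen ?flip_le // flipK.
Qed.

Lemma bDesE w (i : 'I_n) : (i \in bDes w) = (sact w i%:Z > sact w (i%:Z + 1)).
Proof. by rewrite inE -[i%:Z + 1]/((i + 1)%N%:Z) addn1. Qed.

(** No integer lies between k and k + 1, so only the exchanged pair itself can be compared
    differently. For k = 0 that pair would be 1 and -1, excluded by [x != - y], and the value 0 is
    excluded too. *)
Lemma flip_lt_neq (k : nat) x y :
    x != 0 -> y != 0 -> x != y -> x != - y -> (flip k y < flip k x) != (y < x) ->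
  (0 < k)%N /\
  [\/ x = k%:Z /\ y = k%:Z + 1, x = k%:Z + 1 /\ y = k%:Z,
      x = - k%:Z /\ y = - (k%:Z + 1) | x = - (k%:Z + 1) /\ y = - k%:Z].
Proof.
rewrite /flip; case: k => [|k] /=; first by repeat case: ifP => //; lia.
move=> x0 y0 xy xNy h; split=> //.
suff: (x = k.+1%:Z /\ y = k.+1%:Z + 1) \/ (x = k.+1%:Z + 1 /\ y = k.+1%:Z) \/
      (x = - k.+1%:Z /\ y = - (k.+1%:Z + 1)) \/ (x = - (k.+1%:Z + 1) /\ y = - k.+1%:Z).
  by case=> [?|[?|[?|?]]]; [apply: Or41|apply: Or42|apply: Or43|apply: Or44].
by move: h; repeat case: ifP => //; lia.
Qed.

Lemma sact_neq w z z' : `|z| <= n%:Z -> `|z'| <= n%:Z -> z != z' -> z != - z' ->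
  (sact w z != sact w z') && (sact w z != - sact w z').
Proof.
move=> lez lez' zz' zNz'; apply/andP; split.
  by apply: contraNneq zz' => /sact_inj ->.
by apply: contraNneq zNz'; rewrite -sactN => /sact_inj ->; rewrite ?normrN.
Qed.

(* Exchanging adjacent values can only alter the comparison of those two values,
   which must then sit at adjacent positions. *)
Lemma bDes_genl (k : 'I_n) w :
  bDes (gen k * w)%g != bDes w -> exists i : 'I_n, (gen k * w)%g = (w * gen i)%g.
Proof.
move=> neq; have [i ni] : exists i, (i \in bDes (gen k * w)%g) != (i \in bDes w).
  apply/existsP; apply: contraNT neq; rewrite negb_exists => /forallP h.
  by apply/eqP/setP => i; apply/eqP; have := h i; rewrite negbK.
exists i; move: ni; rewrite !bDesE !sactM !sact_gen ?sact_le // => ni.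
have ltin := ltn_ord i.
apply: sact_faithful => z z0 zn; have lez : `|z| <= n%:Z by lia.
rewrite !sactM sact_gen ?sact_le // sact_gen //.
have I0 : sact w z != 0 by have := @sact_neq w z 0; rewrite sact0; lia.
have I1 : sact w (i%:Z + 1) != 0 by have := @sact_neq w (i%:Z + 1) 0; rewrite sact0; lia.
have Ii1 : z != i%:Z + 1 ->
    (sact w z != sact w (i%:Z + 1)) && (sact w z != - sact w (i%:Z + 1)).
  by have := @sact_neq w z (i%:Z + 1); lia.
have [i0 | i0] := eqVneq (i : nat) 0%N.
  have e0 : i%:Z = 0 by lia.
  rewrite e0 add0r sact0 in ni Ii1 I1 *; rewrite i0 {e0 i0 neq}.
  have [k0 W1] : k = 0%N :> nat /\ (sact w 1 = 1 \/ sact w 1 = -1).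
    by move: ni {Ii1 I0}; rewrite flip0 /flip; repeat case: ifP => //; lia.
  rewrite k0 {ni}; have [-> | z1] := eqVneq z 1; first by rewrite /flip /= sactN; case: W1 => ->.
  by have := Ii1 z1; rewrite /flip; repeat case: ifP => //; lia.
have I2 : sact w i%:Z != 0 by have := @sact_neq w i%:Z 0; rewrite sact0; lia.
have /andP[I J] : (sact w i%:Z != sact w (i%:Z + 1)) && (sact w i%:Z != - sact w (i%:Z + 1)).
  by have := @sact_neq w i%:Z (i%:Z + 1); lia.
have Ii : z != i%:Z -> (sact w z != sact w i%:Z) && (sact w z != - sact w i%:Z).
  by have := @sact_neq w z i%:Z; lia.
have [k0 H] := flip_lt_neq I2 I1 I J ni.
have [zi|zi] := eqVneq z i%:Z.
  have -> : flip i z = i%:Z + 1 by rewrite {H ni}/flip; repeat case: ifP => //; lia.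
  by rewrite zi {Ii1 I0 I1 ni Ii I J}; move: H; rewrite /flip => -[] [-> ->]; repeat case: ifP => //; lia.
have [zi1|zi1] := eqVneq z (i%:Z + 1).
  have -> : flip i z = i%:Z by rewrite {H ni}/flip; repeat case: ifP => //; lia.
  by rewrite zi1 {Ii1 I0 I1 ni Ii I J}; move: H; rewrite /flip => -[] [-> ->]; repeat case: ifP => //; lia.
have -> : flip i z = z by rewrite {H ni}/flip; repeat case: ifP => //; lia.
move: {Ii Ii1 ni I J} (Ii zi) (Ii1 zi1).
by case: H => -[-> ->]; rewrite /flip; repeat case: ifP => //; lia.
Qed.

(** Acting on the right exchanges the entries at positions i and i + 1, or negates the first entry
    if i = 0; either way membership of i itself is toggled. *)
Lemma bDes_genr (i : 'I_n) w : bDes (w * gen i)%g != bDes w.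
Proof.
have ltin := ltn_ord i.
apply/eqP => /setP/(_ i); rewrite !bDesE !sactM !sact_gen; try lia.
have I1 : sact w (i%:Z + 1) != 0 by have := @sact_neq w (i%:Z + 1) 0; rewrite sact0; lia.
have [i0 | i0] := eqVneq (i : nat) 0%N.
  have e0 : i%:Z = 0 by lia.
  by move: I1; rewrite e0 i0 add0r /flip /= sactN sact0; lia.
have /andP[I J] : (sact w i%:Z != sact w (i%:Z + 1)) && (sact w i%:Z != - sact w (i%:Z + 1)).
  by have := @sact_neq w i%:Z (i%:Z + 1); lia.
have -> : flip i i%:Z = i%:Z + 1 by rewrite /flip; repeat case: ifP => //; lia.
have -> : flip i (i%:Z + 1) = i%:Z by rewrite /flip; repeat case: ifP => //; lia.
by lia.
Qed.

End SignedGroup.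

Arguments sact {n} w z : simpl never.

(** * Solomon's theorem for signed permutations *)

(** A discrete intermediate value argument: a fall is at most one per step, so the first step
    reaching j or below goes exactly from j + 1 to j. *)
Lemma unit_drop_ivt (P : int -> int) (a b j : int) :
  (forall k, a <= k -> k < b -> P k - 1 <= P (k + 1)) ->
  a <= b -> j < P a -> P b <= j ->
  exists z, [/\ a <= z, z < b, P z = j + 1 & P (z + 1) = j].
Proof.
move=> drop leab; have [m] := ubnP (absz (b - a)).
elim: m a drop leab => // m IH a drop leab ltm ja bj.
have ltab : a < b.
  by rewrite lt_neqAle leab andbT; apply: contraTneq bj => <-; lia.
have := drop a; rewrite lexx => /(_ isT ltab) da.
have [le | gt] := leP (P (a + 1)) j; first by exists a; split; lia.
have [|||z [? ? ? ?]] := IH (a + 1) _ _ _ gt bj; try lia.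
  by move=> k ? ?; apply: drop; lia.
by exists z; split=> //; lia.
Qed.

Lemma increasing_id (Q : int -> int) (m : nat) :
  Q 0 = 0 -> Q m%:Z <= m%:Z ->
  (forall z, 0 <= z -> z < m%:Z -> Q z < Q (z + 1)) ->
  forall z, 0 <= z -> z <= m%:Z -> Q z = z.
Proof.
move=> Q0 Qm inc.
have lo (k : nat) : (k <= m)%N -> k%:Z <= Q k%:Z.
  elim: k => [|k IH] lek; first by rewrite Q0.
  have := inc k%:Z; have -> : k%:Z + 1 = k.+1%:Z by lia.
  by have := IH; lia.
have hi (k : nat) : (k <= m)%N -> Q (m%:Z - k%:Z) <= m%:Z - k%:Z.
  elim: k => [|k IH] lek; first by rewrite subr0.
  have := inc (m%:Z - k.+1%:Z); have -> : m%:Z - k.+1%:Z + 1 = m%:Z - k%:Z by lia.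
  by have := IH; lia.
case=> // k _ lek; have := lo k; have := hi (m - k)%N.
by have -> : m%:Z - (m - k)%N%:Z = k%:Z; lia.
Qed.

Section DescentClasses.
Variable n : nat.
Implicit Types u v w : signed n.

Lemma bDes_sact w w' (j : int) : bDes w = bDes w' -> - n%:Z <= j -> j < n%:Z ->
  (sact w (j + 1) < sact w j) = (sact w' (j + 1) < sact w' j).
Proof.
move=> e lej ltj.
have H (i : nat) : (i < n)%N ->
    (sact w (i%:Z + 1) < sact w i%:Z) = (sact w' (i%:Z + 1) < sact w' i%:Z).
  by move=> lt; rewrite -!(bDesE _ (Ordinal lt)) e.
case: j lej ltj => i lej ltj; first by apply: H; lia.
have -> : Negz i = - (i%:Z + 1) by lia.
have -> : - (i%:Z + 1) + 1 = - i%:Z by lia.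
by rewrite !sactN !ltrN2 H //; lia.
Qed.

(* The minimal elements of descent classes for the left weak order:
   each block of consecutive descents carries consecutive values. *)
Definition block_minimal w := forall k, - n%:Z <= k -> k < n%:Z ->
  sact w^-1%g k - 1 <= sact w^-1%g (k + 1).

(** As the value grows from w(b) to w(a), its position falls from b to a by at most one per step,
    hence passes from j + 1 directly to j. *)
Lemma block_minimal_desc w (a b j : int) : block_minimal w ->
  - n%:Z <= a -> b <= n%:Z -> a <= j -> j < b -> sact w b < sact w a ->
  sact w (j + 1) < sact w j.
Proof.
move=> wmin na bn aj jb lt.
have wa := sact_le w a; have wb := sact_le w b.
have [k ? ?||||z [? ? zj z1]] := @unit_drop_ivt (sact w^-1%g) (sact w b) (sact w a) j.
- by apply: wmin; lia.
- lia.
- by rewrite sactK; lia.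
- by rewrite sactK; lia.
rewrite -zj -[in X in _ < X]z1 !sactKV; lia.
Qed.

Lemma desc_chain w (a b : int) : a < b ->
  (forall j, a <= j -> j < b -> sact w (j + 1) < sact w j) -> sact w b < sact w a.
Proof.
move=> ltab desc; have [m eb] : exists m : nat, b = a + m.+1%:Z.
  by exists (absz (b - a - 1)%R); lia.
have : forall j, a <= j -> j < a + m.+1%:Z -> sact w (j + 1) < sact w j.
  by rewrite -eb.
rewrite {b ltab desc}eb; elim: m => [|m IH] desc; first by apply: desc; lia.
apply: lt_trans (IH _); last by move=> j ? ?; apply: desc; lia.
have -> : a + m.+2%:Z = a + m.+1%:Z + 1 by lia.
by apply: desc; lia.
Qed.

Lemma block_minimal_eq w w' : block_minimal w -> block_minimal w' ->
  bDes w = bDes w' -> w = w'.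
Proof.
move=> wmin w'min e.
(* It suffices that [w' * w^-1] increases. If z precedes z + 1 in [w], an inversion in [w'] would
   force descents throughout the interval in [w'], hence in [w]. Otherwise the two values are
   adjacent in [w] and form a descent shared with [w']. *)
suff E z : 0 < z -> z <= n%:Z -> sact (w' * w^-1)%g z = sact (1%g : signed n) z.
  by rewrite -[LHS]mul1g -(sact_faithful E) mulgKV.
move=> z0 zn; rewrite sact1; last lia.
apply: (@increasing_id _ n) => //; try lia.
  by have := sact_le (w' * w^-1)%g n; lia.
move=> {z0 zn}z z0 zn; rewrite !sactM.
set P := sact w^-1%g.
have lez : `|z| <= n%:Z by lia.
have lez1 : `|z + 1| <= n%:Z by lia.
have P1 : `|P z| <= n%:Z by exact: sact_le.
have P2 : `|P (z + 1)| <= n%:Z by exact: sact_le.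
have PP : P z <> P (z + 1) by move/sact_inj => /(_ lez lez1); lia.
have QQ : sact w' (P z) <> sact w' (P (z + 1)) by move/sact_inj => /(_ P1 P2).
have [lt | le] := ltP (P z) (P (z + 1)); last first.
  have wz : P z - 1 <= P (z + 1) by apply: wmin; lia.
  have E : P z = P (z + 1) + 1 by lia.
  by rewrite E -(bDes_sact e) -?E ?sactKV //; lia.
case: (ltgtP (sact w' (P z)) (sact w' (P (z + 1)))) => // gt.
suff : sact w (P (z + 1)) < sact w (P z) by rewrite !sactKV //; lia.
apply: desc_chain => // j j1 j2; rewrite (bDes_sact e); try lia.
by apply: (@block_minimal_desc w' (P z) (P (z + 1))) => //; lia.
Qed.

(** The pairing of the identity with [w^-1]: by rearrangement it grows on going down in the left
    weak order, so maximal weight replaces minimality. *)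
Definition weight w : int := \sum_(j < n) j.+1%:Z * sact w^-1%g j.+1%:Z.

Lemma weight_gen (k : 'I_n) w :
  sact w^-1%g (k%:Z + 1) < sact w^-1%g k%:Z -> weight w < weight (gen k * w)%g.
Proof.
move=> lt; have ltkn := ltn_ord k.
have -> : weight (gen k * w)%g = \sum_(j < n) j.+1%:Z * sact w^-1%g (flip k j.+1%:Z).
  apply: eq_bigr => j _; have ltj := ltn_ord j.
  have -> : (gen k * w)^-1%g = (w^-1 * gen k)%g.
    by rewrite invMg; congr (_ * _)%g; rewrite -[LHS]mulg1 -(genK k) mulKg.
  by rewrite sactM sact_gen //; lia.
rewrite /weight (bigD1 k) // [ltRHS](bigD1 k) //=.
(* Only summands of moved values change: that of 1 if k = 0, otherwise those of k and k + 1, whose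
   indices are k - 1 and k. *)
have [k0 | k0] := eqVneq (k : nat) 0%N.
  rewrite ltr_leD //; last first.
    apply: ler_sum => j; rewrite -val_eqE /= k0 => j0.
    by have -> // : flip 0 j.+1%:Z = j.+1%:Z; rewrite /flip; repeat case: ifP => //; lia.
  have lt1 : sact w^-1%g 1%N%:Z < 0 by move: lt; rewrite k0.
  have -> : flip k k.+1%:Z = - 1%N%:Z by rewrite /flip k0.
  by rewrite k0 sactN; lia.
have ltk1 : (k.-1 < n)%N by lia.
rewrite (bigD1 (Ordinal ltk1)) ?[X in _ < _ + X](bigD1 (Ordinal ltk1)) -?val_eqE /=; try lia.
rewrite !addrA ltr_leD //; last first.
  apply: ler_sum => j; rewrite -!val_eqE /= => j0.
  by have -> // : flip k j.+1%:Z = j.+1%:Z; rewrite /flip; repeat case: ifP => //; lia.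
have -> : flip k k.+1%:Z = k%:Z by rewrite /flip; repeat case: ifP => //; lia.
have -> : flip k k.-1.+1%:Z = k.+1%:Z by rewrite /flip; repeat case: ifP => //; lia.
have -> : k.-1.+1 = k by lia.
by move: lt; have -> : k%:Z + 1 = k.+1%:Z; nia.
Qed.

Lemma bDes_connected (T : eqType) (f : signed n -> T) :
  (forall (k : 'I_n) w, bDes (gen k * w)%g = bDes w -> f (gen k * w)%g = f w) ->
  forall w w', bDes w = bDes w' -> f w = f w'.
Proof.
move=> fgen.
suff mini w : exists w0, [/\ block_minimal w0, bDes w0 = bDes w & f w0 = f w].
  move=> w w' e; have [u [umin ue <-]] := mini w; have [v [vmin ve <-]] := mini w'.
  by rewrite (block_minimal_eq umin vmin) // ue ve.
(* Fixing the value of [f] along with the descent set replaces a path of moves by a single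
   maximization. *)
pose C := [pred v | (bDes v == bDes w) && (f v == f w)].
have Cw : C w by rewrite /= !eqxx.
have [u /andP[/eqP ue /eqP uf] umax] := arg_maxP weight Cw.
exists u; split=> //.
set P := sact u^-1%g.
have Hpos (k : 'I_n) : P k%:Z - 1 <= P (k%:Z + 1).
  rewrite leNgt; apply/negP => lt; have ltkn := ltn_ord k.
  (* By maximality [gen k] leaves the descent class, so [gen k * u = u * gen i]. The positions of
     the values exchanged by [flip k] are then exchanged by [flip i], which rules out a drop larger
     than one. *)
  have /bDes_genl[i ui] : bDes (gen k * u)%g != bDes u.
    apply/eqP => e; have := umax (gen k * u)%g.
    rewrite /= e fgen // ue uf !eqxx => /(_ isT); apply/negP; rewrite -ltNge.
    by apply: weight_gen; rewrite -/P; lia.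
  have comm z : `|z| <= n%:Z -> P (flip k z) = flip i (P z).
    move=> lez; rewrite /P -(sact_gen k lez) -(sact_gen i (sact_le _ _)) -!sactM; congr (sact _ z).
    by apply: (mulIg u); rewrite mulgKV -mulgA ui mulKg.
  have [k0 | k0] := eqVneq (k : nat) 0%N.
    have e0 : k%:Z = 0 by lia.
    have := comm 1; rewrite k0 {1}/flip /= /P sactN -/P.
    by move: lt; rewrite e0 add0r /P sact0 -/P /flip; repeat case: ifP => //; lia.
  have := comm k%:Z.
  have -> : flip k k%:Z = k%:Z + 1 by rewrite /flip; repeat case: ifP => //; lia.
  have /andP[] : (P k%:Z != P (k%:Z + 1)) && (P k%:Z != - P (k%:Z + 1)).
    by apply: sact_neq; lia.
  by move: lt; rewrite /flip; repeat case: ifP => //; lia.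
case=> k lek ltk; first by have lt : (k < n)%N by [lia]; exact: (Hpos (Ordinal lt)).
have lt : (k < n)%N by lia.
have -> : Negz k = - (k%:Z + 1) by lia.
have -> : - (k%:Z + 1) + 1 = - k%:Z by lia.
by have := Hpos (Ordinal lt); rewrite !sactN -/P /=; lia.
Qed.

(** * Products in the group algebra of $B_n$ *)

Definition bmul (b c : galg (Bn n)) : galg (Bn n) :=
  [ffun w => \sum_(u : signed n) b u * c (u^-1 * (w : signed n))%g].

Lemma SigmaBP (f : galg (Bn n)) :
  in_SigmaB f <-> (forall w w', bDes w = bDes w' -> f w = f w').
Proof. exact: in_span_fibres. Qed.

Lemma SigmaB_bmul b c : in_SigmaB b -> in_SigmaB c -> in_SigmaB (bmul b c).
Proof.
move=> /SigmaBP bD /SigmaBP cD; apply/SigmaBP.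
apply: bDes_connected => k w e; rewrite !ffunE.
pose th (u : signed n) := if bDes (gen k * u)%g == bDes u then (gen k * u)%g else u.
have thK : involutive th.
  move=> u; rewrite {2}/th; case: ifP => eu; rewrite /th ?eu //.
  by rewrite mulgA genK mul1g eq_sym eu.
rewrite (reindex_inj (inv_inj thK)) /=; apply: eq_bigr => u _.
rewrite /th {th thK}; case: ifP => [/eqP eu | /negbT nu].
  by rewrite (bD _ _ eu) invMg -mulgA mulKg.
(* Here s u = u s', so the second factor becomes s' u^-1 w. *)
congr (_ * _); apply: cD.
have [i ui] := bDes_genl nu.
have -> : (u^-1 * (gen k * w))%g = (gen i * (u^-1 * w))%g.
  have -> : gen k = (u * gen i * u^-1)%g by rewrite -ui mulgK.
  by rewrite !mulgA mulVg mul1g.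
(* If the comparison changed, then s w = w s' with s' simple, contradicting Des(s w) = Des(w). *)
apply/eqP; apply: contraT => /bDes_genl[j vj].
have : bDes (gen k * w)%g != bDes w.
  have -> : (gen k * w)%g = (w * gen j)%g.
    have -> : gen k = (u * gen i * u^-1)%g by rewrite -ui mulgK.
    by rewrite -!mulgA vj !mulgA mulgV mul1g.
  exact: bDes_genr.
by rewrite e eqxx.
Qed.

Lemma phi_bmul b c : phi (bmul b c) = smul (phi b) (phi c).
Proof.
apply/ffunP=> x; rewrite !ffunE.
transitivity (\sum_(u : signed n) \sum_(v : signed n | (u * v)%g.1 == x) b u * c v).
  under eq_bigr do rewrite ffunE.
  rewrite exchange_big /=; apply: eq_bigr => u _.
  rewrite (reindex_inj (mulgI u)) /=.
  by apply: eq_bigr => v _; rewrite mulKg.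
transitivity (\sum_(u : signed n) \sum_(v : signed n)
    if scomp u.1 v.1 == x then b u * c v else 0).
  by apply: eq_bigr => u _; rewrite big_mkcond.
rewrite (partition_big (fun u : signed n => u.1) predT) //=; apply: eq_bigr => s _.
rewrite exchange_big (partition_big (fun u : signed n => u.1) predT) //=.
apply: eq_bigr => t _; rewrite !ffunE.
case: ifP => h.
  rewrite mulr_suml exchange_big; apply: eq_bigr => u /eqP us.
  rewrite mulr_sumr; apply: eq_bigr => v /eqP vt.
  by rewrite us vt h.
by apply: big1 => v /eqP vt; apply: big1 => u /eqP us; rewrite us vt h.
Qed.

End DescentClasses.

(** * Forgetting signs *)

(* The name [sval] of Defs is otherwise shadowed by the projection of sigma types. *)
Local Notation sval := Defs.sval.

Lemma sval_ord n (u : 'S_n) (i : 'I_n) : sval u i.+1 = (u i).+1.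
Proof.
by rewrite /sval /= /sword (nth_map i) ?size_enum_ord // nth_ord_enum.
Qed.

Lemma sval_neq n (u : 'S_n) k : (0 < k)%N -> (k < n)%N -> sval u k != sval u k.+1.
Proof.
case: k => // k _ ltk; have ltk' := ltnW ltk.
rewrite (sval_ord u (Ordinal ltk')) (sval_ord u (Ordinal ltk)) eqSS.
by rewrite (inj_eq val_inj) (inj_eq perm_inj) -val_eqE /= neq_ltn ltnSn.
Qed.

(** Being false at 0 and from n on, it allows products over positions to be shifted by one and
    agrees with the convention $u_0=0$ for peaks. *)
Definition descent n (u : 'S_n) (k : nat) : bool :=
  [&& (0 < k)%N, (k < n)%N & (sval u k.+1 < sval u k)%N].

Lemma sDesE n (u : 'S_n) (i : 'I_n) : (i \in sDes u) = descent u i.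
Proof. by rewrite inE /descent ltn_ord. Qed.

Lemma PeakE n (u : 'S_n) (i : 'I_n) :
  (i \in Peak u) = descent u i && ~~ descent u i.-1.
Proof.
rewrite inE /descent ltn_ord /=; case: (posnP i) => //= i0.
rewrite andbC; congr (_ && _).
have lti := ltn_ord i; have lti' : (i.-1 < n)%N by lia.
rewrite lti' /=; have [i1 | i1] := posnP i.-1.
  have -> : nat_of_ord i = (Ordinal lti').+1 by rewrite /=; lia.
  by rewrite sval_ord [(Ordinal lti').+1.-1]i1.
have := @sval_neq n u i.-1 i1; have -> : i.-1.+1 = i by lia.
by lia.
Qed.

Lemma Peak_in_Fn n (u : 'S_n) : in_Fn (Peak u).
Proof.
apply/andP; split.
  by apply/mapP => -[i]; rewrite mem_enum PeakE /descent => h i0; move: h; rewrite -i0.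
apply/'forall_forallP => i j; apply/implyP; rewrite PeakE => /andP[di _].
apply/implyP; rewrite PeakE => /andP[_ dj].
by apply: contraNneq dj => /= ->.
Qed.

Lemma sDes_subset_n1 n (u : 'S_n) : subset_n1 (sDes u).
Proof.
by apply/mapP => -[i]; rewrite mem_enum sDesE /descent => h i0; move: h; rewrite -i0.
Qed.

Lemma PeakP n (f : galg 'S_n) :
  in_Peak f <-> (forall u v, Peak u = Peak v -> f u = f v).
Proof. by apply: in_span_fibres; exact: Peak_in_Fn. Qed.

Lemma SigmaAP n (f : galg 'S_n) :
  in_SigmaA f <-> (forall u v, sDes u = sDes v -> f u = f v).
Proof. by apply: in_span_fibres; exact: sDes_subset_n1. Qed.

Lemma Peak_sub_SigmaA n (f : galg 'S_n) : in_Peak f -> in_SigmaA f.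
Proof.
move=> /PeakP fP; apply/SigmaAP => u v e; apply: fP; apply/setP => i.
have de (k : nat) : (k < n)%N -> descent u k = descent v k.
  by move=> lt; rewrite -!(sDesE _ (Ordinal lt)) e.
by rewrite !PeakE !de //; have := ltn_ord i; lia.
Qed.

Lemma phi_sum n (f : galg (Bn n)) u :
  phi f u = \sum_(e : {ffun 'I_n -> bool}) f (u, e).
Proof.
rewrite ffunE (reindex_onto (fun e => (u, e)) (fun w : Bn n => w.2)) /=.
  by apply: eq_bigl => e; rewrite !eqxx.
by case=> v e /= /eqP ->.
Qed.

Lemma prod_shift (R : comNzRingType) m (F : nat -> R) : F 0%N = 1 -> F m = 1 ->
  \prod_(i < m) F i = \prod_(i < m) F i.+1.
Proof.
move=> F0 Fm; transitivity (\prod_(i < m.+1) F i); first by rewrite big_ord_recr /= Fm mulr1.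
by rewrite big_ord_recl /= F0 mul1r.
Qed.

Lemma eq_set_prod (T : finType) (A B : {set T}) :
  ((A == B)%:R : rat) = \prod_i ((i \in A) == (i \in B))%:R.
Proof.
have [-> | /eqP nAB] := eqVneq A B; first by rewrite big1 // => i _; rewrite eqxx.
have [i ni] : exists i, (i \in A) != (i \in B).
  apply/existsP; apply: contra_notT nAB; rewrite negb_exists => /forallP h.
  by apply/setP => i; apply/eqP; have := h i; rewrite negbK.
by rewrite (bigD1 i) //= (negbTE ni) mul0r.
Qed.

(** * Counting sign choices in type B *)

Section SignCount.
Variable m : nat.
Local Notation n := m.+1.
Implicit Types (u : 'S_n) (e : {ffun 'I_n -> bool}) (J F : {set 'I_n}).

(** The entry of larger absolute value decides the comparison by its sign. Signs are indexed from 0,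
    so position i carries the sign of index i - 1. *)
Lemma mem_bDes u e (i : 'I_n) :
  (i \in bDes (u, e)) = if descent u i then ~~ e (inord i.-1) else e i.
Proof.
have lti := ltn_ord i; rewrite inE /descent lti /= bval_ord sval_ord /=.
have [i0 | i0] := posnP i; first by rewrite i0 bval0 /=; case: (e i); lia.
have lti' : (i.-1 < n)%N by lia.
pose i' := Ordinal lti'; have ei : nat_of_ord i = i'.+1 by rewrite /=; lia.
have -> : inord i.-1 = i' by apply: val_inj; rewrite /= inordK.
have -> : bval (u, e) i = (if e i' then -1 else 1) * (u i').+1%:Z.
  by rewrite ei (bval_ord (u, e)).
have -> : sval u i = (u i').+1 by rewrite ei sval_ord.
have : u i != u i' by rewrite (inj_eq perm_inj) -val_eqE /=; lia.
by rewrite -val_eqE /=; case: (e i); case: (e i'); case: ifP; lia.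
Qed.

(* The sign at position j is forced by an ascent at j-1 and by a descent at j:
   twice at a peak, not at all at a valley. *)
Lemma phi_YB J u :
  phi (YB J) u =
  \prod_(i in Peak u) (if (inord i.-1 \in J) != (i \in J) then 2 else 0).
Proof.
rewrite phi_sum.
pose free (k : nat) (b : bool) : rat := if descent u k then 1 else (b == (inord k \in J))%:R.
pose forced (k : nat) (b : bool) : rat := if descent u k then (~~ b == (inord k \in J))%:R else 1.
have d0 : descent u 0 = false by [].
have dn : descent u n = false by rewrite /descent ltnn andbF.
transitivity (\sum_(e : {ffun 'I_n -> bool}) \prod_(j < n) (free j (e j) * forced j.+1 (e j))).
  apply: eq_bigr => e _; rewrite ffunE eq_set_prod big_split /=.
  rewrite [X in _ = _ * X](eq_bigr (fun j : 'I_n => forced j.+1 (e (inord j.+1.-1)))); last first.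
    by move=> j _; rewrite /= inord_val.
  rewrite -(@prod_shift _ n (fun k => forced k (e (inord k.-1)))) /forced ?d0 ?dn //.
  rewrite -big_split /=; apply: eq_bigr => i _.
  by rewrite mem_bDes /free inord_val; case: ifP; rewrite ?mul1r ?mulr1.
(* Each sign now occurs in one factor only, so the sum over sign vectors splits into a product. *)
rewrite -(bigA_distr_bigA (fun (j : 'I_n) b => free j b * forced j.+1 b)) /=.
(* [half] spreads the weight 2 of each valley over the adjacent steps, so that only peaks contribute. *)
pose half (b : bool) : rat := if b then 2^-1 else 1.
pose peak (k : nat) : rat := if descent u k && ~~ descent u k.-1 then
  (if (inord k.-1 \in J) != (inord k \in J) then 2 else 0) else 1.
transitivity (\prod_(j < n) (2 * half (~~ descent u j) * (half (descent u j.+1) * peak j.+1))).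
  apply: eq_bigr => j _; rewrite big_bool /= /free /forced /half /peak /=.
  case: (descent u j); case: (descent u j.+1) => /=;
    case: (inord j \in J); case: (inord j.+1 \in J) => /=; lra.
rewrite big_split /= -(@prod_shift _ n (fun k => half (descent u k) * peak k)); last first.
- by rewrite dn /peak dn /half mulr1.
- by rewrite d0 /peak d0 /half mulr1.
rewrite -big_split [RHS]big_mkcond /=; apply: eq_bigr => i _.
rewrite PeakE /peak inord_val /half.
by case: (descent u i); case: ifP => _ //=; lra.
Qed.

Lemma phi_YB_neq0 J u :
  (phi (YB J) u != 0) = [forall i in Peak u, (inord i.-1 \in J) != (i \in J)].
Proof.
rewrite phi_YB; apply/prodf_neq0/forall_inP => h i /h.
  by case: ifP; rewrite ?eqxx.
by move=> ->; rewrite pnatr_eq0.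
Qed.

Definition switch_set F : {set 'I_n} :=
  [set i : 'I_n | odd (\sum_(k < i.+1) (inord k \in F))].

Lemma switch_setP F (i : 'I_n) : (0 < i)%N ->
  ((inord i.-1 \in switch_set F) != (i \in switch_set F)) = (i \in F).
Proof.
move=> i0; have lti := ltn_ord i; rewrite !inE inordK; last lia.
have -> : i.-1.+1 = i by lia.
by rewrite big_ord_recr /= inord_val oddD; case: odd; case: (i \in F).
Qed.

Lemma phi_YB_switch F u : (phi (YB (switch_set F)) u != 0) = (Peak u \subset F).
Proof.
rewrite phi_YB_neq0; apply/forall_inP/subsetP => h i iP.
  by rewrite -switch_setP ?h //; move: iP; rewrite inE => /andP[].
by rewrite switch_setP ?h //; move: iP; rewrite inE => /andP[].
Qed.

Definition flip_sign (j : 'I_n) e := [ffun i => e i (+) (i == j)].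

Lemma flip_signK j : involutive (flip_sign j).
Proof. by move=> e; apply/ffunP=> i; rewrite !ffunE -addbA addbb addbF. Qed.

Lemma inDn_flip_sign u e j : inDn (u, flip_sign j e) = ~~ inDn (u, e).
Proof.
have cardE (e' : {ffun 'I_n -> bool}) : #|[set i | e' i]| = (\sum_i e' i)%N.
  by rewrite -sum1dep_card big_mkcond; apply: eq_bigr => i _; case: (e' i).
rewrite /inDn /= !cardE (bigD1 j) //= [in RHS](bigD1 j) //= ffunE eqxx.
rewrite (eq_bigr (fun i => e i : nat)) => [|i /negbTE ij]; last by rewrite ffunE ij addbF.
by rewrite !oddD addbT; case: (e j); rewrite /= ?negbK.
Qed.

End SignCount.

(** * Counting even sign choices in type D *)

Section TypeD.
Variable m : nat.
Local Notation n := m.+2.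
Implicit Types (u : 'S_n) (e : {ffun 'I_n -> bool}) (J F : {set 'I_n}).

Lemma mem_dDes u e (i : 'I_n) :
  (i \in dDes (u, e)) = if i == ord0 then
    (if descent u 1 then e ord0 else e (inord 1)) else (i \in bDes (u, e)).
Proof.
rewrite -val_eqE /= !inE; case: ifP => // i0.
have b1 : bval (u, e) 1 = (if e ord0 then -1 else 1) * (u ord0).+1%:Z.
  exact: (bval_ord (u, e) ord0).
have e1 : (inord 1 : 'I_n) = 1%N :> nat by rewrite inordK.
have b2 : bval (u, e) 2 = (if e (inord 1) then -1 else 1) * (u (inord 1)).+1%:Z.
  by have := bval_ord (u, e) (inord 1); rewrite e1.
have s1 : sval u 1 = (u ord0).+1 by exact: (sval_ord u ord0).
have s2 : sval u 2 = (u (inord 1)).+1 by have := sval_ord u (inord 1); rewrite e1.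
rewrite /descent s1 s2 b1 b2 /=.
have : u ord0 != u (inord 1) by rewrite (inj_eq perm_inj) -val_eqE /= e1.
by rewrite -val_eqE /=; case: (e ord0); case: (e _); case: ifP; lia.
Qed.

(** [u^-1 ord0] locates the entry of absolute value 1, which is never the larger of two compared
    entries. *)
Lemma dDes_flip_min u e :
  dDes (u, flip_sign (u^-1%g ord0) e) = dDes (u, e).
Proof.
apply/setP => i; have lti := ltn_ord i.
have desc_lt (k : 'I_n) : (0 < k)%N -> descent u k = (u k < u (inord k.-1))%N.
  move=> k0; have ltk := ltn_ord k; rewrite /descent ltk k0 sval_ord.
  have {1}-> : k = (inord k.-1 : 'I_n).+1 :> nat by rewrite inordK; lia.
  by rewrite sval_ord.
have asc_lt (k : 'I_n) : (0 < k)%N -> ~~ descent u k = (u (inord k.-1) < u k)%N.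
  move=> k0; rewrite desc_lt //.
  have : u k != u (inord k.-1).
    by rewrite (inj_eq perm_inj) -val_eqE /= inordK; have := ltn_ord k; lia.
  by rewrite -val_eqE /=; lia.
have flipE (j : 'I_n) : (0 < u j)%N -> flip_sign (u^-1%g ord0) e j = e j.
  move=> uj; rewrite ffunE (_ : (j == _) = false) ?addbF //.
  by apply: contraTF uj => /eqP ->; rewrite permKV.
have e1 : (inord 1 : 'I_n) = 1%N :> nat by rewrite inordK.
have i1 : inord 1.-1 = ord0 :> 'I_n by apply/val_inj; rewrite /= inordK.
rewrite !mem_dDes; case: eqVneq => [_ | i0].
  have := desc_lt (inord 1); have := asc_lt (inord 1); rewrite e1 i1 => /(_ isT) a /(_ isT) d.
  by case: ifPn; rewrite ?a ?d => h; rewrite flipE //; lia.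
have {}i0 : (0 < i)%N by move: i0; rewrite -val_eqE lt0n.
rewrite !mem_bDes; have := desc_lt i i0; have := asc_lt i i0.
by move=> a d; case: ifPn; rewrite ?a ?d => h; rewrite flipE //; lia.
Qed.

(** Flipping the sign of the smallest entry preserves [dDes] and exchanges even and odd sign
    vectors. *)
Lemma phi_YD_half J u :
  2 * phi (YD J) u = \sum_(e : {ffun 'I_n -> bool}) (dDes (u, e) == J)%:R.
Proof.
rewrite mulr_natl mulr2n phi_sum.
rewrite {2}(reindex_inj (inv_inj (flip_signK (u^-1%g ord0)))) -big_split /=.
apply: eq_bigr => e _; rewrite !ffunE dDes_flip_min inDn_flip_sign.
by case: inDn; rewrite /= ?addr0 ?add0r.
Qed.

Lemma eq_setD1 (T : finType) (x : T) (A B : {set T}) :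
  (A == B) = (A :\ x == B :\ x) && ((x \in A) == (x \in B)).
Proof.
apply/eqP/andP => [-> | [/eqP/setP h /eqP hx]]; first by rewrite !eqxx.
apply/setP => y; have := h y; rewrite !inE.
by case: eqVneq => [-> _|] //=.
Qed.

(** If 1 is a peak, the conditions at 1' and at 0 coincide, leaving only the halving. Otherwise 1'
    and 1 test the same sign, so [J] must agree there, and the freed first sign compensates the
    halving. *)
Lemma phi_YD J u : phi (YD J) u = phi (YB J) u *
  (if inord 1 \in Peak u then 2^-1 else ((ord0 \in J) == (inord 1 \in J))%:R).
Proof.
have e1 : (inord 1 : 'I_n) = 1%N :> nat by rewrite inordK.
have i1 : inord 1.-1 = ord0 :> 'I_n by apply/val_inj; rewrite /= inordK.
have n10 : (inord 1 == ord0 :> 'I_n) = false by rewrite -val_eqE /= e1.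
rewrite PeakE e1 andbT; have := phi_YD_half J u.
case: ifPn => d1 halfE.
  suff E : 2 * phi (YD J) u = phi (YB J) u by rewrite -E; lra.
  rewrite halfE phi_sum; apply: eq_bigr => e _; rewrite [RHS]ffunE; congr (_ == _)%:R.
  apply/setP => i; rewrite mem_dDes d1; case: eqVneq => // ->.
  by rewrite mem_bDes.
have d0 e : (ord0 \in bDes (u, e)) = e ord0 by rewrite mem_bDes.
have D0 e : (ord0 \in dDes (u, e)) = (inord 1 \in bDes (u, e)).
  by rewrite mem_dDes eqxx (negbTE d1) mem_bDes e1 (negbTE d1).
have DD e : dDes (u, e) :\ ord0 = bDes (u, e) :\ ord0.
  by apply/setP => i; rewrite !in_setD1 mem_dDes; case: eqVneq.
have [J01 | J01] := eqVneq (ord0 \in J) (inord 1 \in J); last first.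
  rewrite mulr0; suff E : 2 * phi (YD J) u = 0 by lra.
  rewrite halfE big1 // => e _; case: eqP => // E.
  by move: (D0 e) J01; rewrite -E mem_dDes eqxx mem_dDes n10 => ->; rewrite eqxx.
suff E : 2 * phi (YD J) u = 2 * phi (YB J) u by rewrite mulr1; lra.
rewrite halfE mulr_natl mulr2n phi_sum.
(* Pairing each vector with the one of opposite first sign removes the type B condition at 0. *)
rewrite [X in _ = _ + X](reindex_inj (inv_inj (flip_signK ord0))) -big_split /=.
apply: eq_bigr => e _; rewrite !ffunE.
have fl : bDes (u, flip_sign ord0 e) :\ ord0 = bDes (u, e) :\ ord0.
  apply/setP => i; rewrite !in_setD1; case: eqVneq => //= i0.
  rewrite !mem_bDes; case: ifP => di; rewrite ffunE ?(negbTE i0) ?addbF //.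
  case: eqVneq => [ii | _]; last by rewrite addbF.
  have ei : i = 1%N :> nat.
    move/(congr1 val): ii; rewrite /= inordK; last by have := ltn_ord i; lia.
    by move: i0; rewrite -val_eqE /=; lia.
  by move: di; rewrite ei (negbTE d1).
rewrite !(eq_setD1 ord0 _ J) fl DD D0 !d0 ffunE eqxx addbT.
have [E | _] := eqVneq (bDes (u, e) :\ ord0) (J :\ ord0); last by rewrite addr0.
have /setP/(_ (inord 1)) := E; rewrite !in_setD1 n10 /= => ->; rewrite J01 eqxx.
by case: (e ord0); case: (inord 1 \in J).
Qed.

End TypeD.

(** Triangular inversion: subtracting a multiple of [phi (Y J)] from [PF F] leaves only peak sets
    properly inside [F], whence induction on the size of [F]. *)
Lemma Peak_spanned n (Y : {set 'I_n} -> galg (Bn n)) :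
  (forall J u v, Peak u = Peak v -> phi (Y J) u = phi (Y J) v) ->
  (forall F, in_Fn F -> exists J,
     (forall u, Peak u = F -> phi (Y J) u != 0) /\
     (forall u, phi (Y J) u != 0 -> Peak u \subset F)) ->
  forall f, in_Peak f <-> exists b, in_span predT Y b /\ f = phi b.
Proof.
move=> Yconst Ytri f.
pose S (g : galg 'S_n) := exists c : {set 'I_n} -> rat,
  forall u, g u = \sum_J c J * phi (Y J) u.
have phiE (c : {set 'I_n} -> rat) u :
    phi [ffun w => \sum_(J | predT J) c J * Y J w] u = \sum_J c J * phi (Y J) u.
  rewrite ffunE; under eq_bigr do rewrite ffunE.
  by rewrite exchange_big; apply: eq_bigr => J _; rewrite ffunE mulr_sumr.
have S0 : S 0 by exists (fun=> 0) => u; rewrite ffunE big1 // => J _; rewrite mul0r.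
have SD g h : S g -> S h -> S (g + h).
  move=> [c cE] [d dE]; exists (fun J => c J + d J) => u.
  by rewrite ffunE cE dE -big_split; apply: eq_bigr => J _; rewrite mulrDl.
have SZ a g : S g -> S [ffun u => a * g u].
  move=> [c cE]; exists (fun J => a * c J) => u.
  by rewrite ffunE cE mulr_sumr; apply: eq_bigr => J _; rewrite mulrA.
have sumE (c : {set 'I_n} -> rat) :
    [ffun u => \sum_(F | in_Fn F) c F * PF F u] =
    \sum_(F | in_Fn F) [ffun u => c F * PF F u] :> galg 'S_n.
  by apply/ffunP=> u; rewrite ffunE sum_ffunE; apply: eq_bigr => F _; rewrite [RHS]ffunE.
have SPF k (F : {set 'I_n}) : (#|F| < k)%N -> in_Fn F -> S (PF F).
  elim: k F => // k IH F ltF FF.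
  have [u0 /eqP u0F | noF] := pickP [pred u | Peak u == F]; last first.
    suff -> : PF F = 0 by [].
    by apply/ffunP=> u; rewrite !ffunE; have /= -> := noF u.
  have [J [JF Jsub]] := Ytri F FF; pose a := phi (Y J) u0.
  have a0 : a != 0 by apply: JF.
  pose h : galg 'S_n := [ffun u => PF F u - a^-1 * phi (Y J) u].
  have [|c hE] := (PeakP h).2.
    by move=> u v e; rewrite ffunE [RHS]ffunE (Yconst J u v e) /PF !ffunE e.
  have -> : PF F = [ffun u => a^-1 * phi (Y J) u] + h.
    by apply/ffunP=> u; rewrite !ffunE addrC subrK.
  apply: (SD).
    apply: SZ; exists (fun K => (K == J)%:R) => u.
    by rewrite (bigD1 J) //= eqxx mul1r big1 ?addr0 // => K /negbTE ->; rewrite mul0r.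
  rewrite hE sumE; apply: (big_ind S S0 SD) => F' FF'.
  (* Outside the proper subsets of [F] the coefficient in [h] vanishes: at [F] by the choice of [a],
     elsewhere by the support of [phi (Y J)]. *)
  have [/andP[sub ltc] | nsub] := boolP ((F' \subset F) && (#|F'| < #|F|)%N).
    by apply/SZ/IH => //; lia.
  suff -> : [ffun u => c F' * PF F' u] = 0 :> galg 'S_n by [].
  apply/ffunP=> u; rewrite !ffunE; case: eqP => [uF' | _]; last by rewrite mulr0.
  have hu : h u = c F'.
    rewrite hE ffunE (bigD1 F') //= ffunE uF' eqxx mulr1 big1 ?addr0 // => G /andP[_ nG].
    by rewrite ffunE uF' eq_sym (negbTE nG) mulr0.
  rewrite mulr1 -hu ffunE [PF F u]ffunE uF'.
  have [E | nF] := eqVneq F' F.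
    by rewrite (Yconst J u u0) ?uF' ?E // -/a mulVf // subrr.
  have [-> | /Jsub] := eqVneq (phi (Y J) u) 0; first by rewrite mulr0 subr0.
  rewrite uF' => sub; case/negP: nsub; rewrite sub /=.
  by apply: proper_card; rewrite properEneq nF.
split=> [[c ->] | [b [[c ->] ->]]]; last first.
  by apply/PeakP => u v e; rewrite !phiE; apply: eq_bigr => J _; rewrite (Yconst J u v e).
have [c' cE] : S [ffun u => \sum_(F | in_Fn F) c F * PF F u].
  by rewrite sumE; apply: (big_ind S S0 SD) => F FF; apply/SZ/(SPF #|F|.+1).
exists [ffun w => \sum_(J | predT J) c' J * Y J w]; split; first by exists c'.
by apply/ffunP=> u; rewrite cE phiE.
Qed.

Lemma Peak_phi_SigmaB n (f : galg 'S_n.+1) :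
  in_Peak f <-> exists b, in_SigmaB b /\ f = phi b.
Proof.
apply: Peak_spanned => [J u v e | F _]; first by rewrite !phi_YB e.
by exists (switch_set F); split=> u; rewrite phi_YB_switch // => ->.
Qed.

Lemma Peak_phi_SigmaD n (f : galg 'S_n.+1) :
  in_Peak f <-> exists d, in_SigmaD d /\ f = phi d.
Proof.
apply: Peak_spanned; case: n {f} => [|m].
- by move=> J u v _; congr (phi _ _); apply/permP => i; rewrite !ord1.
- by move=> J u v e; rewrite !phi_YD !phi_YB e.
- move=> F FF; exists set0.
  have F0 : F = set0.
    apply/setP => i; rewrite inE (ord1 i); apply/negP => F0.
    by case/andP: FF => /mapP[]; exists ord0; rewrite ?mem_enum.
  have P0 (u : 'S_1) : Peak u = set0.
    by apply/setP => i; rewrite !inE (ord1 i).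
  split=> u; last by rewrite P0 F0 subxx.
  move=> _; rewrite phi_sum (bigD1 [ffun=> false]) //= ffunE.
  have -> : inDn (u, [ffun=> false]).
    rewrite /inDn (_ : [set i | _] = set0) ?cards0 //.
    by apply/setP => i; rewrite !inE ffunE.
  (* For n = 1 the missing entry $w_2$ is read as the default 0, so the identity has no descent at
     1'. *)
  have -> : dDes (u, [ffun=> false]) == set0 :> {set 'I_1}.
    apply/eqP/setP => i; rewrite !inE (ord1 i) /=.
    rewrite (bval_ord (u, [ffun=> false]) ord0) /= ffunE.
    by rewrite (@bval_out 1 (u, [ffun=> false]) 2) //; lia.
  rewrite gt_eqF // ltr_pwDl // sumr_ge0 // => e _.
  by rewrite ffunE ler0n.
- move=> F FF; exists (switch_set F).
  have e1 : (inord 1 : 'I_m.+2) = 1%N :> nat by rewrite inordK.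
  have i1 : inord 1.-1 = ord0 :> 'I_m.+2 by apply/val_inj; rewrite /= inordK.
  split=> u; last first.
    by rewrite phi_YD mulf_eq0 negb_or phi_YB_switch => /andP[].
  move=> uF; rewrite phi_YD mulf_neq0 ?phi_YB_switch ?uF //.
  (* If 1 is not in [F], the switching set does not change between 0 and 1, so the type D factor is
     1. *)
  case: ifPn => // nF; have := @switch_setP _ F (inord 1).
  by rewrite e1 i1 (negbTE nF) => /(_ isT)/negbFE ->.
Qed.

Theorem theorem4p2 (n : nat) (hn : (0 < n)%N) :
  (* P_n is contained in Sigma(A_{n-1}) ... *)
  (forall f, in_Peak f -> @in_SigmaA n f) /\
  (* ... and closed under the product of Q S_n (a subalgebra) *)
  (forall f g, in_Peak f -> in_Peak g -> @in_Peak n (smul f g)) /\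
  (* P_n = phi(Sigma(B_n)) *)
  (forall f, @in_Peak n f <-> exists b, in_SigmaB b /\ f = phi b) /\
  (* P_n = psi(Sigma(D_n)) *)
  (forall f, @in_Peak n f <-> exists d, in_SigmaD d /\ f = phi d).
Proof.
case: n hn => // n _; split; first exact: Peak_sub_SigmaA.
split; last by split; [exact: Peak_phi_SigmaB | exact: Peak_phi_SigmaD].
move=> f g /Peak_phi_SigmaB[b [bB ->]] /Peak_phi_SigmaB[c [cB ->]].
apply/Peak_phi_SigmaB; exists (bmul b c); rewrite phi_bmul; split=> //.
exact: SigmaB_bmul.
Qed.
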